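(* There exists a $4$-regular graph $G$ of girth at least $5$ such that $\alpha_G(\lambda) > \alpha_{H_{4,6}}(\lambda)$ for every real $\lambda > 37$.
   Context: Graphs are finite and simple. For a graph $G$, $i_k(G)$ denotes the number of independent sets of $G$ with exactly $k$ vertices (so $i_0(G)=1$, the empty set being counted). The partition function (independence polynomial) of $G$ is $P_G(\lambda)=\sum_{k\ge 0} i_k(G)\lambda^k$, and the occupancy fraction of $G$ at fugacity $\lambda$ is $\alpha_G(\lambda)=\frac{\lambda P_G'(\lambda)}{|V(G)|\,P_G(\lambda)}$. $H_{4,6}$ denotes the $(4,6)$-cage: the unique $4$-regular graph of girth $6$ on $26$ vertices, i.e. the point-line incidence graph of the projective plane $PG(2,3)$ of order $3$. *)

(* Defs.v *)
From HB Require Import structures.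
From mathcomp Require Import all_boot all_order all_algebra.
From mathcomp Require Import reals.

Set Implicit Arguments.
Unset Strict Implicit.
Unset Printing Implicit Defensive.

Import Order.TTheory GRing.Theory Num.Theory.
Local Open Scope ring_scope.

Record sgraph := SGraph {
  vertex :> finType;
  adj : rel vertex;
  adj_sym : symmetric adj;
  adj_irrefl : irreflexive adj
}.

Definition regular (d : nat) (G : sgraph) : Prop :=
  forall x : G, #|[set y : G | adj x y]| = d.

(* The bound 2 < size c excludes the sequences [::] and [:: x; y], which
   satisfy ucycle but are not graph cycles. *)
Definition girth_at_least (g : nat) (G : sgraph) : Prop :=
  forall c : seq G, (2 < size c)%N -> ucycle (@adj G) c -> (g <= size c)%N.

Definition independent (G : sgraph) (S : {set G}) : bool :=
  [forall x in S, forall y in S, ~~ adj x y].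

Definition num_indep (G : sgraph) (k : nat) : nat :=
  #|[set S : {set G} | independent S & #|S| == k]|.

(* Independent sets have at most #|G| vertices, so the sum over k stops
   there. *)
Definition indep_poly (R : realType) (G : sgraph) : {poly R} :=
  \poly_(k < #|G|.+1) (num_indep G k)%:R.

Definition occupancy (R : realType) (G : sgraph) (lambda : R) : R :=
  (lambda * (indep_poly R G)^`().[lambda]) /
  (#|G|%:R * (indep_poly R G).[lambda]).

Section IncidenceGraph.
Variables (P L : finType) (I : P -> L -> bool).

Definition incidence_adj (u v : P + L) : bool :=
  match u, v with
  | inl p, inr l => I p l
  | inr l, inl p => I p l
  | _, _ => false
  end.

Fact incidence_adj_sym : symmetric incidence_adj.
Proof. by case=> ? []. Qed.

Fact incidence_adj_irrefl : irreflexive incidence_adj.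
Proof. by case. Qed.

Definition incidence_graph : sgraph :=
  SGraph incidence_adj_sym incidence_adj_irrefl.

End IncidenceGraph.

(* A d-dimensional subspace of F^n, encoded by the canonical matrix <<A>>
   having it as row space: two such matrices with the same row space are
   equal (genmxP). *)
Definition subspace (F : finFieldType) (n d : nat) : finType :=
  {A : 'M[F]_n | (<<A>>%MS == A) && (\rank A == d)}.

(* The points and lines of PG(2, F) are the subspaces of F^3 of dimension 1
   and 2. *)
Definition pg2_incidence (F : finFieldType)
    (p : subspace F 3 1) (l : subspace F 3 2) : bool :=
  (val p <= val l)%MS.

Definition pg2_incidence_graph (F : finFieldType) : sgraph :=
  incidence_graph (@pg2_incidence F).

Definition H_4_6 : sgraph := pg2_incidence_graph 'F_3.

(* Main.v *)
(* The graph G is the incidence graph of the cyclic configuration on Z/18 in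
   which the point p lies on the lines p, p + 1, p + 3 and p + 7: the
   differences of {0, 1, 3, 7} are pairwise distinct modulo 18, so two points
   share at most one line.  Both P_G and P_H are obtained by summing
   X^|S| (1 + X)^(number of lines missed by S) over the sets S of points.  The
   claim is then the positivity of 26 P_G' P_H - 36 P_H' P_G above 37, and all
   the coefficients of this polynomial in X - 37 are nonnegative, with a
   positive constant one. *)

Require Import Defs.
From Stdlib Require Import NArith.
From HB Require Import structures.
From mathcomp Require Import all_boot all_order all_algebra.
From mathcomp Require Import reals zify.

Set Implicit Arguments.
Unset Strict Implicit.
Unset Printing Implicit Defensive.

Import Order.TTheory GRing.Theory Num.Theory.
Local Open Scope ring_scope.

(** * Polynomials with natural number coefficients, as computable lists *)

(** The coefficients are binary numbers so that products with large coefficients stay cheap under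
    [vm_compute]. *)
Fixpoint polyN (R : nzRingType) (s : seq N) : {poly R} :=
  if s is c :: s' then (N.to_nat c)%:R + 'X * polyN R s' else 0.

Fixpoint np_add (s t : seq N) : seq N :=
  match s, t with
  | [::], _ => t
  | _, [::] => s
  | c :: s', d :: t' => N.add c d :: np_add s' t'
  end.

Fixpoint np_mul (s t : seq N) : seq N :=
  if s is c :: s' then np_add (map (N.mul c) t) (0%num :: np_mul s' t)
  else [::].

Fixpoint np_deriv (s : seq N) : seq N :=
  if s is _ :: s' then np_add s' (0%num :: np_deriv s') else [::].

Fixpoint np_comp (s t : seq N) : seq N :=
  if s is c :: s' then np_add [:: c] (np_mul t (np_comp s' t)) else [::].

(** Subtraction is truncated, so the result is only a candidate difference; it is validated
    afterwards by adding it back with [np_add]. *)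
Fixpoint np_sub (s t : seq N) : seq N :=
  match s, t with
  | c :: s', d :: t' => N.sub c d :: np_sub s' t'
  | _, _ => s
  end.

Section NpolyTheory.
Variable R : comNzRingType.
Local Notation polyN := (polyN R).

Lemma polyN_add s t : polyN (np_add s t) = polyN s + polyN t.
Proof.
elim: s t => [|c s IH] [|d t] /=; rewrite ?add0r ?addr0 //.
have -> : N.to_nat (N.add c d) = (N.to_nat c + N.to_nat d)%N by lia.
by rewrite IH natrD mulrDr addrACA.
Qed.

Lemma polyN_scale c t :
  polyN (map (N.mul c) t) = (N.to_nat c)%:R * polyN t.
Proof.
elim: t => [|d t IH] /=; first by rewrite mulr0.
have -> : N.to_nat (N.mul c d) = (N.to_nat c * N.to_nat d)%N by lia.
by rewrite IH natrM mulrDr mulrCA.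
Qed.

Lemma polyN_mul s t : polyN (np_mul s t) = polyN s * polyN t.
Proof.
elim: s => [|c s IH] /=; first by rewrite mul0r.
by rewrite polyN_add polyN_scale /= IH add0r mulrDl mulrA.
Qed.

Lemma polyN_deriv s : polyN (np_deriv s) = (polyN s)^`().
Proof.
elim: s => [|c s IH] /=; first by rewrite deriv0.
rewrite polyN_add /= IH add0r derivD derivM derivX mul1r.
by rewrite -polyC_natr derivC add0r.
Qed.

Lemma polyN_comp s t : polyN (np_comp s t) = polyN s \Po polyN t.
Proof.
elim: s => [|c s IH]; first by rewrite comp_poly0.
rewrite [LHS]polyN_add polyN_mul IH /= mulr0 addr0.
by rewrite comp_polyD comp_polyM comp_polyX -polyC_natr comp_polyC.
Qed.

End NpolyTheory.

Lemma polyN_ge0 (R : realDomainType) s (x : R) :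
  0 <= x -> 0 <= (polyN R s).[x].
Proof.
move=> x0; elim: s => [|c s IH] /=; first by rewrite horner0.
by rewrite hornerD hornerM hornerX -polyC_natr hornerC addr_ge0 ?mulr_ge0.
Qed.

Lemma polyN_gt0 (R : realDomainType) c s (x : R) :
  c <> 0%num -> 0 <= x -> 0 < (polyN R (c :: s)).[x].
Proof.
move=> c0 x0 /=; rewrite hornerD hornerM hornerX -polyC_natr hornerC.
rewrite ltr_wpDr ?mulr_ge0 ?polyN_ge0 // ltr0n; lia.
Qed.

(** * The independence polynomial of a bipartite graph, by recursion on points *)

(** Each point is either left out or chosen; choosing it costs a factor ['X] and forbids its lines.
    The lines that survive to the end are chosen freely, each giving a factor [1 + 'X]. *)
Fixpoint bipoly (R : nzRingType) (A B : Type) (J : A -> B -> bool)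
    (ps : seq A) (ls : seq B) : {poly R} :=
  if ps is p :: ps' then
    bipoly R J ps' ls + 'X * bipoly R J ps' [seq l <- ls | ~~ J p l]
  else (1 + 'X) ^+ size ls.

Section Bipoly.
Variable R : comNzRingType.

Lemma eq_bipoly (A B : Type) (J K : A -> B -> bool) :
  J =2 K -> bipoly R J =2 bipoly R K.
Proof.
move=> JK; elim=> [|p ps IH] ls //=; rewrite !IH.
by rewrite (@eq_filter _ _ (fun l => ~~ K p l)) // => l; rewrite JK.
Qed.

Lemma bipoly_map (A A' B B' : Type) (J : A -> B -> bool)
    (f : A' -> A) (g : B' -> B) ps ls :
  bipoly R J (map f ps) (map g ls) =
  bipoly R (fun p l => J (f p) (g l)) ps ls.
Proof.
by elim: ps ls => [|p ps IH] ls /=; rewrite ?size_map // filter_map !IH.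
Qed.

(** The line [l] survives every filter, being an isolated vertex of the graph. *)
Lemma bipoly_free (A B : Type) (J : A -> B -> bool) ps s1 s2 l :
    ~~ has (J^~ l) ps ->
  bipoly R J ps (s1 ++ l :: s2) = (1 + 'X) * bipoly R J ps (s1 ++ s2).
Proof.
elim: ps s1 s2 => [|p ps IH] s1 s2 /=.
  by rewrite -exprS !size_cat addnS.
case/norP=> Jpl nl; rewrite IH // !filter_cat /= Jpl IH //.
by rewrite mulrDr mulrCA.
Qed.

End Bipoly.

(** * Evaluation of [bipoly] by dynamic programming on sets of uncovered lines *)

(* A trie of depth [size ls] stores, for each set of lines still uncovered
   (left branches), the weight of the point sets that leave it uncovered. *)
Inductive trie := Void | Node of seq N & trie & trie.

Fixpoint trie_add (t u : trie) : trie :=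
  match t, u with
  | Void, _ => u
  | _, Void => t
  | Node v a b, Node w c d => Node (np_add v w) (trie_add a c) (trie_add b d)
  end.

Fixpoint trie_scale (s : seq N) (t : trie) : trie :=
  if t is Node w a b then Node (np_mul s w) (trie_scale s a) (trie_scale s b)
  else Void.

(** Choosing a point covers its lines, so at each of those levels the left branch is merged into the
    right one. Only weights at full depth carry meaning, whence the [[::]] at inner nodes. *)
Fixpoint trie_cover (bs : bitseq) (t : trie) : trie :=
  match t, bs with
  | Void, _ => Void
  | _, [::] => t
  | Node w a b, c :: bs' =>
    if c then Node [::] Void (trie_add (trie_cover bs' a) (trie_cover bs' b))
    else Node [::] (trie_cover bs' a) (trie_cover bs' b)
  end.

Fixpoint trie_collapse (bs : bitseq) (t : trie) : trie :=
  match t, bs with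
  | Void, _ => Void
  | _, [::] => t
  | Node w a b, c :: bs' =>
    if c then trie_add (trie_scale [:: 1; 1]%num (trie_collapse bs' a))
                (trie_collapse bs' b)
    else Node [::] (trie_collapse bs' a) (trie_collapse bs' b)
  end.

Fixpoint trie_init (n : nat) : trie :=
  if n is n'.+1 then Node [::] (trie_init n') Void
  else Node [:: 1%num] Void Void.

(* A line that meets none of the remaining points contributes a factor 1 + X
   if it is uncovered, hence can be removed at once: this keeps the trie
   small. *)
Fixpoint transfer (A B : Type) (J : A -> B -> bool)
    (ps : seq A) (ls : seq B) (t : trie) : seq N :=
  let done := fun l => ~~ has (J^~ l) ps in
  let t' := trie_collapse (map done ls) t in
  let ls' := [seq l <- ls | ~~ done l] in
  match ps with
  | [::] => if t' is Node w _ _ then w else [::]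
  | p :: ps' =>
    transfer J ps' ls'
      (trie_add t' (trie_scale [:: 0; 1]%num (trie_cover (map (J p) ls') t')))
  end.

Section Trie.
Variables (R : comNzRingType) (A B : Type) (J : A -> B -> bool).
Implicit Types (t u : trie) (ls : seq B) (k : seq B -> {poly R}).

(** The meaning of a trie as a linear functional: a leaf of weight [w], reached by a path whose
    uncovered lines form [s], contributes [w] times [k s]. The case [k := bipoly R J ps] is the
    invariant of [transfer]. *)
Fixpoint trie_sum t ls k : {poly R} :=
  if t is Node w a b then
    if ls is l :: ls' then
      trie_sum a ls' (fun s => k (l :: s)) + trie_sum b ls' k
    else polyN R w * k [::]
  else 0.

Lemma eq_trie_sum t ls k1 k2 : k1 =1 k2 -> trie_sum t ls k1 = trie_sum t ls k2.
Proof.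
elim: t ls k1 k2 => [|w a IHa b IHb] [|l ls] k1 k2 //= eqk.
  by rewrite eqk.
by congr (_ + _); [apply: IHa => s | apply: IHb].
Qed.

Lemma trie_sum_mull t ls c k :
  trie_sum t ls (fun s => c * k s) = c * trie_sum t ls k.
Proof.
elim: t ls k => [|w a IHa b IHb] [|l ls] k /=; rewrite ?mulr0 //.
  by rewrite mulrCA.
by rewrite IHb (IHa _ (fun s => k (l :: s))) mulrDr.
Qed.

Lemma trie_sum_addr t ls k1 k2 :
  trie_sum t ls (fun s => k1 s + k2 s) = trie_sum t ls k1 + trie_sum t ls k2.
Proof.
elim: t ls k1 k2 => [|w a IHa b IHb] [|l ls] k1 k2 /=; rewrite ?addr0 //.
  by rewrite mulrDr.
rewrite IHb (IHa _ (fun s => k1 (l :: s)) (fun s => k2 (l :: s))).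
by rewrite addrACA.
Qed.

Lemma trie_sum_add t u ls k :
  trie_sum (trie_add t u) ls k = trie_sum t ls k + trie_sum u ls k.
Proof.
elim: t u ls k => [|w a IHa b IHb] [|v c d] [|l ls] k /=;
  rewrite ?add0r ?addr0 //.
  by rewrite polyN_add mulrDl.
by rewrite IHa IHb addrACA.
Qed.

Lemma trie_sum_scale s t ls k :
  trie_sum (trie_scale s t) ls k = polyN R s * trie_sum t ls k.
Proof.
elim: t ls k => [|w a IHa b IHb] [|l ls] k /=; rewrite ?mulr0 //.
  by rewrite polyN_mul mulrA.
by rewrite IHa IHb mulrDr.
Qed.

Lemma trie_sum_cover (c : pred B) t ls k :
  trie_sum (trie_cover (map c ls) t) ls k =
  trie_sum t ls (fun s => k [seq l <- s | ~~ c l]).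
Proof.
elim: t ls k => [|w a IHa b IHb] [|l ls] k //=.
by case: (c l) => /=; rewrite ?add0r ?trie_sum_add IHa IHb.
Qed.

(** By hypothesis a line satisfying [c] leaves [k] as a factor [1 + 'X]; scaling the left branch by
    it makes both branches refer to the same remaining lines, so they can be merged. *)
Lemma trie_sum_collapse (c : pred B) t ls k :
    (forall l s1 s2, c l -> k (s1 ++ l :: s2) = (1 + 'X) * k (s1 ++ s2)) ->
  trie_sum (trie_collapse (map c ls) t) [seq l <- ls | ~~ c l] k =
  trie_sum t ls k.
Proof.
elim: t ls k => [|w a IHa b IHb] [|l ls] k //= free_k.
have free_kl l' s1 s2 : c l' ->
    k (l :: s1 ++ l' :: s2) = (1 + 'X) * k (l :: s1 ++ s2).
  exact: (free_k l' (l :: s1)).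
case: ifPn => [cl|cl] /=; last by rewrite IHa // IHb.
rewrite trie_sum_add trie_sum_scale IHa // IHb // /= mulr0 addr0 mulr1.
rewrite -trie_sum_mull; congr (_ + _); apply: eq_trie_sum => s.
by rewrite (free_k l [::]).
Qed.

Lemma trie_sum_init ls k : trie_sum (trie_init (size ls)) ls k = k ls.
Proof.
elim: ls k => [|l ls IH] k /=; first by rewrite mulr0 addr0 mul1r.
by rewrite IH addr0.
Qed.

(** Collapsing preserves the sum, and adding the covered trie scaled by ['X] reproduces the
    recursive equation of [bipoly]. *)
Lemma polyN_transfer ps ls t :
  polyN R (transfer J ps ls t) = trie_sum t ls (bipoly R J ps).
Proof.
elim: ps ls t => [|p ps IH] ls t.
  (* Without points every line is done, so collapsing all levels leaves a single leaf. *)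
  rewrite -(@trie_sum_collapse (fun=> true)); last first.
    by move=> l s1 s2 _; rewrite bipoly_free.
  rewrite /= filter_pred0.
  by case: (trie_collapse _ t) => [|w a b] //=; rewrite expr0 mulr1.
rewrite -(@trie_sum_collapse (fun l => ~~ has (J^~ l) (p :: ps))); last first.
  by move=> l s1 s2 ?; rewrite bipoly_free.
rewrite [in LHS]/transfer -/transfer IH trie_sum_add trie_sum_scale.
rewrite trie_sum_cover /= mulr0 addr0 mulr1 add0r.
by rewrite -trie_sum_mull -trie_sum_addr.
Qed.

Lemma bipoly_transfer ps ls :
  bipoly R J ps ls = polyN R (transfer J ps ls (trie_init (size ls))).
Proof. by rewrite polyN_transfer trie_sum_init. Qed.

End Trie.

(** * From independent sets of incidence graphs to [bipoly] *)

(** Restricting to a vertex set [V] inside a fixed graph allows induction by deleting vertices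
    without forming induced subgraphs. *)
Definition indep_gen (R : nzRingType) (G : sgraph) (V : {set G}) : {poly R} :=
  \sum_(S : {set G} | independent S && (S \subset V)) 'X^#|S|.

Lemma independentP (G : sgraph) (S : {set G}) :
  reflect {in S &, forall x y, ~~ adj x y} (independent S).
Proof.
apply: (iffP forall_inP) => [h x y xS yS|h x xS].
  by have /forall_inP := h x xS; apply.
by apply/forall_inP => y yS; apply: h.
Qed.

Lemma indep_poly_gen (R : realType) (G : sgraph) :
  indep_poly R G = indep_gen R [set: G].
Proof.
rewrite /indep_poly /indep_gen poly_def.
rewrite (eq_bigl (@independent G)); last by move=> S; rewrite subsetT andbT.
(* The sets are grouped by cardinality; [inord] loses nothing, since a cardinality is at most
   [#|G|]. *)
rewrite (partition_big (fun S : {set G} => inord #|S| : 'I_#|G|.+1) xpredT) //=.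
apply: eq_bigr => k _; rewrite /num_indep -sum1dep_card natr_sum scaler_suml.
have card_ord (S : {set G}) : (inord #|S| == k) = (#|S| == k).
  by rewrite -val_eqE /= inordK // ltnS max_card.
apply: eq_big => [S|S]; first by rewrite card_ord.
by case/andP=> _ /eqP->; rewrite scale1r.
Qed.

Section IndepGen.
Variables (R : comNzRingType) (G : sgraph).

(** The first term counts the sets avoiding [v]; removing [v] from the others leaves the independent
    sets among its non-neighbours. *)
Lemma indep_genU1 (v : G) (V : {set G}) : v \notin V ->
  indep_gen R (v |: V) =
  indep_gen R V + 'X * indep_gen R [set y in V | ~~ adj v y].
Proof.
move=> vV; rewrite /indep_gen (bigID (fun S : {set G} => v \notin S)) /=.
congr (_ + _).
  apply: eq_bigl => S; rewrite -andbA; congr (_ && _).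
  apply/andP/idP => [[/subsetP SV vS]|SV].
    apply/subsetP => x xS; have := SV x xS; rewrite in_setU1.
    by case/predU1P => // xv; rewrite -xv xS in vS.
  by rewrite (subset_trans SV (subsetUr _ _)) (contra (subsetP SV v)).
rewrite big_distrr /=.
(* The round-trip condition [(v |: S) :\ v = S] of this reindexing encodes that [v] is not in
   [S]. *)
rewrite (reindex_onto (fun S => v |: S) (fun S => S :\ v)) /=; last first.
  by move=> S /andP[_]; rewrite negbK => vS; rewrite setD1K.
apply: eq_big => [S|S].
  rewrite setU11 /= andbT; apply/andP/andP.
    case=> /andP[/independentP iS /subsetP SV] /eqP vS.
    have vnS : v \notin S by rewrite -vS setD11.
    split; first by apply/independentP => x y xS yS; apply: iS; apply: setU1r.
    apply/subsetP => x xS; rewrite inE iS ?setU11 ?setU1r // andbT.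
    have := SV x (setU1r _ xS); rewrite in_setU1 => /predU1P[xv|//].
    by rewrite -xv xS in vnS.
  case=> /independentP iS /subsetP SV.
  have vnS : v \notin S.
    by apply/negP => /SV; rewrite inE (negPf vV).
  split; last by rewrite setU1K.
  rewrite setUS; last first.
    by apply/subsetP => x /SV; rewrite inE => /andP[].
  rewrite andbT; apply/independentP => x y /setU1P[->|xS] /setU1P[->|yS].
  - by rewrite adj_irrefl.
  - by have := SV y yS; rewrite inE => /andP[].
  - by have := SV x xS; rewrite inE adj_sym => /andP[].
  - exact: iS.
case/andP=> _ /eqP vS; have vnS : v \notin S by rewrite -vS setD11.
by rewrite cardsU1 vnS exprS.
Qed.

Lemma indep_gen0 : indep_gen R (set0 : {set G}) = 1.
Proof.
rewrite /indep_gen (big_pred1 set0) ?cards0 // => S; rewrite subset0 andbC /=.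
by case: (S =P set0) => //= ->; apply/independentP => x y; rewrite inE.
Qed.

End IndepGen.

Section IncidenceGen.
Variables (R : comNzRingType) (P L : finType) (I : P -> L -> bool).
Local Notation G := (incidence_graph I).

Lemma indep_gen_incidence (ps : seq P) (ls : seq L) : uniq ps -> uniq ls ->
  indep_gen R
    [set x : G | match x with inl p => p \in ps | inr l => l \in ls end] =
  bipoly R I ps ls.
Proof.
pose V (ps : seq P) (ls : seq L) :=
  [set x : G | match x with inl p => p \in ps | inr l => l \in ls end].
rewrite -/(V ps ls).
elim: ps ls => [|p ps IH] ls /= => [_|/andP[pps ups]].
  elim: ls => [|l ls IH] /= => [_|/andP[lls uls]].
    rewrite -[RHS](indep_gen0 R G); congr (indep_gen R _).
    by apply/setP => -[x|x]; rewrite !inE.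
  have -> : V [::] (l :: ls) = inr l |: V [::] ls.
    by apply/setP => -[x|x]; rewrite !inE.
  rewrite indep_genU1 ?inE // exprS -IH // mulrDl mul1r.
  (* Lines are pairwise non-adjacent, so choosing [l] deletes no other line. *)
  congr (_ + 'X * indep_gen R _).
  by apply/setP => -[x|x]; rewrite !inE //= andbT.
move=> uls; have -> : V (p :: ps) ls = inl p |: V ps ls.
  by apply/setP => -[x|x]; rewrite !inE.
rewrite indep_genU1 ?inE // -!IH ?filter_uniq //.
congr (_ + 'X * indep_gen R _); apply/setP => -[x|x].
  by rewrite !inE /= andbT.
by rewrite !inE /= mem_filter andbC.
Qed.

End IncidenceGen.

(** Numbering points and lines replaces the abstract incidence by a relation [J] on natural numbers,
    on which [transfer] can be run. *)
Lemma indep_poly_incidence (R : realType) (P L : finType) (I : P -> L -> bool)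
    (m n : nat) (f : 'I_m -> P) (g : 'I_n -> L) (J : nat -> nat -> bool) :
    bijective f -> bijective g -> (forall i j, I (f i) (g j) = J i j) ->
  indep_poly R (incidence_graph I) =
  polyN R (transfer J (iota 0 m) (iota 0 n) (trie_init n)).
Proof.
move=> bf bg IJ; rewrite -[in trie_init n](size_iota 0 n) -bipoly_transfer.
rewrite -(val_enum_ord m) -(val_enum_ord n) bipoly_map -(eq_bipoly _ IJ).
rewrite -bipoly_map -indep_gen_incidence ?(map_inj_uniq (bij_inj bf))
  ?(map_inj_uniq (bij_inj bg)) ?enum_uniq //.
rewrite indep_poly_gen; congr (indep_gen R _); apply/setP => x.
rewrite !inE; have [f' _ fK] := bf; have [g' _ gK] := bg.
by case: x => x; rewrite -[x](fK, gK) map_f ?mem_enum.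
Qed.

Lemma card_incidence_graph (P L : finType) (I : P -> L -> bool) (m n : nat)
    (f : 'I_m -> P) (g : 'I_n -> L) :
  bijective f -> bijective g -> #|incidence_graph I| = (m + n)%N.
Proof.
by move=> /bij_eq_card bf /bij_eq_card bg; rewrite card_sum -bf -bg !card_ord.
Qed.

(** * Coordinates for the points and lines of PG(2, 3) *)

Lemma inj_surj_bij (S T : choiceType) (f : S -> T) :
  injective f -> (forall y, exists x, f x = y) -> bijective f.
Proof.
move=> injf surjf; have ex y : exists x, f x == y.
  by have [x <-] := surjf y; exists x.
exists (fun y => xchoose (ex y)) => [x|y]; last exact/eqP/(xchooseP (ex y)).
exact/injf/eqP/(xchooseP (ex (f x))).
Qed.

(* One representative of each point of PG(2, 3), with leading coordinate 1; a
   line is represented by the vector orthogonal to it. *)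
Definition pg23_coords : seq (seq nat) :=
  [seq [:: 1; a; b] | a <- iota 0 3, b <- iota 0 3]%N ++
  [seq [:: 0; 1; a] | a <- iota 0 3]%N ++ [:: [:: 0; 0; 1]%N].

Definition pg23_coord (i k : nat) : nat := nth 0%N (nth [::] pg23_coords i) k.

Definition pg23_vec (i : nat) : 'rV['F_3]_3 := \row_k (pg23_coord i k)%:R.

Definition pg23_orthogonal (i j : nat) : bool :=
  (3 %| sumn [seq pg23_coord i k * pg23_coord j k | k <- iota 0 3])%N.

Lemma natr_F3 (n : nat) : (n%:R == 0 :> 'F_3) = (3 %| n)%N.
Proof. by rewrite (dvdn_pcharf (pchar_Fp (isT : prime 3))). Qed.

Lemma pg23_vec_neq0 (i : 'I_13) : pg23_vec i != 0.
Proof.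
have /allP/(_ i) : all (fun i => has (fun k => ~~ (3 %| pg23_coord i k))%N
  (iota 0 3)) (iota 0 13) by [].
rewrite mem_iota ltn_ord => /(_ isT) /hasP[k].
rewrite mem_iota => /andP[_ k3]; apply: contra => /eqP/rowP/(_ (Ordinal k3)).
by rewrite !mxE /= => /eqP; rewrite natr_F3.
Qed.

(** An exhaustive check over the 27 coordinate triples, done with natural numbers modulo 3; [x] is
    the scalar relating [u] to its representative. *)
Lemma pg23_vec_complete (u : 'rV['F_3]_3) : u != 0 ->
  exists i : 'I_13, (u <= pg23_vec i)%MS.
Proof.
have /allP H : all (fun a => all (fun b => all (fun c =>
    (a + b + c == 0) || has (fun i => has (fun x =>
      all (fun k => x * pg23_coord i k == nth 0 [:: a; b; c] k %[mod 3])
        (iota 0 3))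
      (iota 0 3)) (iota 0 13)) (iota 0 3)) (iota 0 3))%N (iota 0 3).
  by [].
have F3 k : (u 0 k : nat) \in iota 0 3 by rewrite mem_iota ltn_ord.
set k0 : 'I_3 := ord0; set k1 : 'I_3 := @Ordinal 3 1 isT.
set k2 : 'I_3 := @Ordinal 3 2 isT.
have /allP/(_ _ (F3 k1))/allP/(_ _ (F3 k2)) := H _ (F3 k0).
case/orP=> [|/hasP[i]].
  rewrite !addn_eq0 -andbA => /and3P[u0 u1 u2] /eqP[].
  by apply/rowP => -[[|[|[|//]]] k3]; rewrite mxE; apply/val_inj/eqP;
    [move: u0 | move: u1 | move: u2]; congr (nat_of_ord (u 0 _) == _);
    apply/val_inj.
rewrite mem_iota => /andP[_ i13] /hasP[x _ /allP ux] _.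
exists (Ordinal i13); apply/sub_rVP; exists x%:R; apply/rowP => k.
rewrite !mxE /= -natrM -(natr_Zp (u 0 k)).
have := ux k; rewrite mem_iota ltn_ord => /(_ isT) xk.
rewrite -(Fp_nat_mod (isT : prime 3) (x * _)) (eqP xk) Fp_nat_mod //.
by case: k {xk} => [[|[|[|//]]] k3] /=;
  congr (_%:R); congr nat_of_ord; congr (u 0 _); apply/val_inj.
Qed.

Lemma pg23_vec_orthogonal (i j : nat) :
  (pg23_vec i *m (pg23_vec j)^T == 0) = pg23_orthogonal i j.
Proof.
rewrite /pg23_orthogonal -natr_F3 sumnE big_map natr_sum.
rewrite -val_enum_ord big_map big_enum /=.
transitivity ((pg23_vec i *m (pg23_vec j)^T) 0 0 == 0).
  apply/eqP/eqP => [->|h]; first by rewrite mxE.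
  by apply/rowP => k; rewrite ord1 h mxE.
by rewrite mxE; congr (_ == _); apply: eq_bigr => k _; rewrite !mxE natrM.
Qed.

(** Used for the injectivity of both numberings: a line is determined by its points and, by
    symmetry, a point by its lines. *)
Lemma pg23_orthogonal_inj (i j : 'I_13) :
  (forall k : 'I_13, pg23_orthogonal k i = pg23_orthogonal k j) -> i = j.
Proof.
have /allP H : all (fun i => all (fun j => (i == j) ||
    has (fun k => pg23_orthogonal k i != pg23_orthogonal k j) (iota 0 13))
  (iota 0 13)) (iota 0 13) by [].
have I13 (k : 'I_13) : (k : nat) \in iota 0 13 by rewrite mem_iota ltn_ord.
have /allP/(_ _ (I13 j))/orP[/eqP/val_inj //|/hasP[k]] := H _ (I13 i).
rewrite mem_iota => /andP[_ k13] + eqij.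
by rewrite (eqij (Ordinal k13)) eqxx.
Qed.

Lemma pg23_orthogonalC (i j : nat) : pg23_orthogonal i j = pg23_orthogonal j i.
Proof.
rewrite /pg23_orthogonal; congr (_ %| sumn _)%N.
by apply: eq_map => k; rewrite mulnC.
Qed.

Fact pg23_point_subproof (i : 'I_13) :
  (<< <<pg23_vec i>> >>%MS == <<pg23_vec i>>%MS) &&
  (\rank <<pg23_vec i>> == 1%N).
Proof. by rewrite genmx_id eqxx genmxE rank_rV pg23_vec_neq0. Qed.

Definition pg23_point (i : 'I_13) : subspace 'F_3 3 1 :=
  exist _ <<pg23_vec i>>%MS (pg23_point_subproof i).

Lemma rank_pg23_ker (i : 'I_13) : \rank (kermx (pg23_vec i)^T) = 2%N.
Proof. by rewrite mxrank_ker mxrank_tr rank_rV pg23_vec_neq0. Qed.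

Fact pg23_line_subproof (i : 'I_13) :
  (<< <<kermx (pg23_vec i)^T>> >>%MS == <<kermx (pg23_vec i)^T>>%MS) &&
  (\rank <<kermx (pg23_vec i)^T>> == 2%N).
Proof. by rewrite genmx_id eqxx genmxE rank_pg23_ker. Qed.

Definition pg23_line (i : 'I_13) : subspace 'F_3 3 2 :=
  exist _ <<kermx (pg23_vec i)^T>>%MS (pg23_line_subproof i).

Lemma pg23_incidence (i j : 'I_13) :
  pg2_incidence (pg23_point i) (pg23_line j) = pg23_orthogonal i j.
Proof.
by rewrite /pg2_incidence /= !genmxE sub_kermx pg23_vec_orthogonal.
Qed.

(** For surjectivity, a nonzero row of [A] spans it and lies in the span of a representative;
    equality of ranks turns the inclusion into equality. *)
Lemma pg23_point_bij : bijective pg23_point.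
Proof.
apply: inj_surj_bij => [i j eqij|[A propA]].
  apply: pg23_orthogonal_inj => k.
  by rewrite !(pg23_orthogonalC k) -!pg23_incidence eqij.
have /andP[/eqP genA /eqP rA] := propA.
have [i uA] : exists i : 'I_13, (nz_row A <= pg23_vec i)%MS.
  by apply: pg23_vec_complete; rewrite nz_row_eq0 -mxrank_eq0 rA.
have uE : (nz_row A :=: A)%MS.
  apply/eqmxP; rewrite -(mxrank_leqif_eq (nz_row_sub A)).
  by rewrite rA rank_rV nz_row_eq0 -mxrank_eq0 rA.
exists i; apply/val_inj; rewrite /= -genA; apply/esym/eq_genmx/eqmxP.
rewrite -(mxrank_leqif_eq (_ : A <= _)%MS) -?uE // uE.
by rewrite rA rank_rV pg23_vec_neq0.
Qed.

(** For surjectivity, a plane in dimension 3 has a nonzero normal vector. Its representative has an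
    orthogonal space that contains [A] and has the same rank 2. *)
Lemma pg23_line_bij : bijective pg23_line.
Proof.
apply: inj_surj_bij => [i j eqij|[A propA]].
  by apply: pg23_orthogonal_inj => k; rewrite -!pg23_incidence eqij.
have /andP[/eqP genA /eqP rA] := propA.
have K0 : kermx A^T != 0 by rewrite -mxrank_eq0 mxrank_ker mxrank_tr rA.
have [i /sub_rVP[a uE]] :
    exists i : 'I_13, (nz_row (kermx A^T) <= pg23_vec i)%MS.
  by apply: pg23_vec_complete; rewrite nz_row_eq0.
(* A nonzero scalar can be cancelled, so the representative itself is orthogonal to [A]. *)
have a0 : a != 0.
  by apply: contraNneq K0 => a0; rewrite -nz_row_eq0 uE a0 scale0r.
have AK : (A <= kermx (pg23_vec i)^T)%MS.
  apply/sub_kermxP/trmx_inj; rewrite trmx_mul trmxK trmx0.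
  apply: (scalerI a0); rewrite scaler0 scalemxAl -uE.
  by apply/sub_kermxP/nz_row_sub.
exists i; apply/val_inj; rewrite /= -genA; apply/esym/eq_genmx/eqmxP.
by rewrite -(mxrank_leqif_eq AK) rA rank_pg23_ker.
Qed.

(** * Regularity and girth of incidence graphs *)

Section Regularity.
Variables (P L : finType) (I : P -> L -> bool).
Local Notation G := (incidence_graph I).

Lemma incidence_regular d :
    (forall p, #|[set l | I p l]| = d) -> (forall l, #|[set p | I p l]| = d) ->
  regular d G.
Proof.
move=> dP dL [p|l].
  rewrite -(dP p) -(card_imset _ (@inr_inj P L)); apply: eq_card => y.
  rewrite inE /=; apply/idP/imsetP => [|[l]]; last by rewrite inE => ? ->.
  by case: y => // l pl; exists l; rewrite ?inE.
rewrite -(dL l) -(card_imset _ (@inl_inj P L)); apply: eq_card => y.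
rewrite inE /=; apply/idP/imsetP => [|[p]]; last by rewrite inE => ? ->.
by case: y => // p pl; exists p; rewrite ?inE.
Qed.

Lemma incidence_girth :
    (forall p p' l l', I p l -> I p l' -> I p' l -> I p' l' ->
      p = p' \/ l = l') ->
  girth_at_least 5 G.
Proof.
(* Only lengths 3 and 4 need an argument; a triangle is impossible in a bipartite graph. *)
move=> I2 [|x [|y [|z [|t [|? ?]]]]] //= _; first by case: x y z => ? [] ? [] ?;
  rewrite /ucycle /= ?andbF.
case/andP; rewrite /= andbT !inE.
(* A 4-cycle, started at a point or at a line, gives two points on two common lines. *)
case: x y z t => x [] y // [] z // [] t; rewrite /= ?andbF // negb_or.
  case/and4P=> xy zy zt xt /and3P[/andP[xz _] yt _].
  have [e|e] := I2 x z y t xy xt zy zt; first by rewrite e eqxx in xz.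
  by rewrite e eqxx in yt.
case/and4P=> yx yz tz tx /and3P[/andP[xz _] yt _].
have [e|e] := I2 y t x z yx yz tx tz; first by rewrite e eqxx in yt.
by rewrite e eqxx in xz.
Qed.

End Regularity.

Lemma card_ord_set n (Q : pred nat) :
  #|[set i : 'I_n | Q i]| = count Q (iota 0 n).
Proof.
rewrite cardsE cardE size_filter -val_enum_ord count_map enumT.
by apply: eq_count.
Qed.

(** * The cyclic configuration on Z/18 *)

Definition Z18_incidence (p l : nat) : bool :=
  has (fun d => (p + d) %% 18 == l)%N [:: 0; 1; 3; 7]%N.

Definition Z18_graph : sgraph :=
  incidence_graph (fun p l : 'I_18 => Z18_incidence p l).

Lemma Z18_regular : regular 4 Z18_graph.
Proof.
have I18 (k : 'I_18) : (k : nat) \in iota 0 18 by rewrite mem_iota ltn_ord.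
apply: incidence_regular => x.
  have /allP H : all (fun p => count (Z18_incidence p) (iota 0 18) == 4)
    (iota 0 18) by vm_compute.
  exact: etrans (card_ord_set 18 _) (eqP (H x (I18 x))).
have /allP H : all (fun l => count (Z18_incidence^~ l) (iota 0 18) == 4)
  (iota 0 18) by vm_compute.
exact: etrans (card_ord_set 18 (Z18_incidence^~ x))
  (eqP (H x (I18 x))).
Qed.

Lemma Z18_girth : girth_at_least 5 Z18_graph.
Proof.
apply: incidence_girth => p p' l l' pl pl' p'l p'l'.
have I18 (k : 'I_18) : (k : nat) \in iota 0 18 by rewrite mem_iota ltn_ord.
(* The property of differences is verified directly, by counting the common lines of every pair of
   points. *)
have /allP H : all (fun p => all (fun p' => (p == p') ||
    (count (fun l => Z18_incidence p l && Z18_incidence p' l)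
      (iota 0 18) <= 1)%N)
  (iota 0 18)) (iota 0 18) by vm_compute.
have /allP/(_ _ (I18 p'))/orP[/eqP/val_inj|] := H _ (I18 p); first by left.
rewrite -(card_ord_set 18 (fun l => Z18_incidence p l && Z18_incidence p' l)).
move=> /card_le1_eqP eql.
by right; apply: eql; rewrite inE; apply/andP.
Qed.

(** * The two polynomials and their comparison *)

Definition H_4_6_coeffs : seq N :=
  [:: 1; 26; 273; 1508; 4784; 8970; 10036; 7020; 3666; 1664; 598; 156; 26;
      2]%num.

Definition Z18_coeffs : seq N :=
  [:: 1; 36; 558; 4908; 27189; 99612; 246990; 418500; 487530; 397660; 240444;
      119808; 53199; 20628; 6624; 1668; 306; 36; 2]%num.

Lemma indep_poly_H_4_6 (R : realType) :
  indep_poly R H_4_6 = polyN R H_4_6_coeffs.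
Proof.
have -> : H_4_6_coeffs =
    transfer pg23_orthogonal (iota 0 13) (iota 0 13) (trie_init 13).
  by vm_compute.
exact: indep_poly_incidence pg23_point_bij pg23_line_bij pg23_incidence.
Qed.

Lemma indep_poly_Z18 (R : realType) :
  indep_poly R Z18_graph = polyN R Z18_coeffs.
Proof.
have -> : Z18_coeffs =
    transfer Z18_incidence (iota 0 18) (iota 0 18) (trie_init 18).
  by vm_compute.
have id_bij : bijective (@id 'I_18) by exists id.
exact: (indep_poly_incidence R id_bij id_bij).
Qed.

(* The hypothesis [t' = np_add s' d] says that no truncation occurs in [d],
   i.e., that [t'] dominates [s'] coefficientwise. *)
Lemma polyN_lt (R : realFieldType) (s t : seq N) (a : N) (x : R) :
    let s' := np_comp s [:: a; 1]%num in
    let t' := np_comp t [:: a; 1]%num in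
    let d := np_sub t' s' in
    t' = np_add s' d -> head 0%num d <> 0%num -> (N.to_nat a)%:R < x ->
  (polyN R s).[x] < (polyN R t).[x].
Proof.
move=> s' t' d t'E d0 ax.
(* Taylor shift: nonnegative coefficients in [x - a] make the sign evident for [x > a]. *)
have shift r : (polyN R r).[x] =
    (polyN R (np_comp r [:: a; 1]%num)).[x - (N.to_nat a)%:R].
  rewrite polyN_comp horner_comp /= mulr0 addr0 mulr1 -polyC_natr.
  by rewrite hornerD hornerX hornerC addrC subrK.
rewrite !shift -/s' -/t' t'E polyN_add hornerD ltrDl.
have x0 : 0 <= x - (N.to_nat a)%:R by rewrite subr_ge0 ltW.
(* The default value 0 of [head] rules out an empty [d]. *)
by case: (d) d0 => [/(_ erefl)|c r /= c0] //; apply: polyN_gt0.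
Qed.

Theorem theorem3p2 (R : realType) :
  exists G : sgraph,
    [/\ regular 4 G,
        girth_at_least 5 G &
        forall lambda : R, 37%:R < lambda ->
          occupancy H_4_6 lambda < occupancy G lambda].
Proof.
exists Z18_graph.
split; [exact: Z18_regular | exact: Z18_girth | move=> x x37].
have id_bij : bijective (@id 'I_18) by exists id.
rewrite /occupancy (card_incidence_graph _ pg23_point_bij pg23_line_bij).
rewrite (card_incidence_graph _ id_bij id_bij).
rewrite indep_poly_H_4_6 indep_poly_Z18.
have x0 : 0 < x by rewrite (lt_trans _ x37) ?ltr0n.
have H0 : 0 < (polyN R H_4_6_coeffs).[x] by apply: polyN_gt0 => //; apply: ltW.
have G0 : 0 < (polyN R Z18_coeffs).[x] by apply: polyN_gt0 => //; apply: ltW.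
rewrite ltr_pdivrMr ?mulr_gt0 ?ltr0n // mulrAC ltr_pdivlMr ?mulr_gt0 ?ltr0n //.
rewrite -!mulrA ltr_pM2l //.
(* The vertex counts 36 and 26 become constant polynomials, so that each side of the inequality is
   the value of one coefficient list. *)
have const n : (polyN R [:: n]).[x] = (N.to_nat n)%:R.
  by rewrite /= mulr0 addr0 -polyC_natr hornerC.
have -> : (18 + 18)%:R = (polyN R [:: 36%num]).[x] by rewrite const.
have -> : (13 + 13)%:R = (polyN R [:: 26%num]).[x] by rewrite const.
rewrite -!hornerM -!polyN_deriv -!polyN_mul.
apply: (@polyN_lt R _ _ 37%num) x37; by vm_compute.
Qed.
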